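(* Let $A$ be an $\ell$-controllable complete group system with generator group $(\mathcal{U},\circ)$. Fix $t\in\mathbf{Z}$ and $k$ with $0\le k\le\ell$. The set $\nabla_{0,k}^t(\mathcal{U})$ with the operation $\circledcirc_{0,k}^t$ defined by $$\nabla_{0,k}^t(\dot{\mathbf{u}})\circledcirc_{0,k}^t\nabla_{0,k}^t(\ddot{\mathbf{u}})=\nabla_{0,k}^t(\dot{\mathbf{u}}\circ\ddot{\mathbf{u}})$$ forms a group $(\nabla_{0,k}^t(\mathcal{U}),\circledcirc_{0,k}^t)$.
   Context: Let $(A^t)_{t\in\mathbf{Z}}$ be finite groups. A group system $A$ is a set of sequences $\mathbf{a}=(a^t)_{t\in\mathbf{Z}}$, $a^t\in A^t$, forming a group under componentwise operation, such that every element of $A^t$ occurs as a time-$t$ component, for each $t$. $\chi^t:A\to A^t$ is $\mathbf{a}\mapsto a^t$. $A$ is $\ell$-controllable ($\ell>0$) if for every $t\in\mathbf{Z}$ and all $\dot{\mathbf{a}},\ddot{\mathbf{a}}\in A$ there is $\mathbf{a}\in A$ agreeing with $\dot{\mathbf{a}}$ at all times $<t$ and with $\ddot{\mathbf{a}}$ at all times $\ge t+\ell$. $A$ is complete if every sequence in $\prod_t A^t$ whose restriction to each finite interval is the restriction of some element of $A$ belongs to $A$. $A^{[m,n]}$ is the set of sequences in $A$ that are the identity outside $[m,n]$. $X^t$ (resp. $Y^t$) is the normal subgroup of sequences in $A$ that are the identity at all times $<t$ (resp. $>t$). Basis: for $t\in\mathbf{Z}$, $0\le k\le\ell$ put $\Lambda^{[t,t+k]}=X^{t+1}(X^t\cap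 Y^{t+k})/X^{t+1}(X^t\cap Y^{t+k-1})$. A basis is a choice, for each $(k,t)$, of a transversal $[\Lambda^{[t,t+k]}]$ whose elements (generators $\mathbf{g}^{[t,t+k]}$) lie in $A^{[t,t+k]}$ and in which the trivial coset is represented by the identity sequence. $\mathcal{R}=\prod_{t\in\mathbf{Z}}\prod_{0\le k\le\ell}[\Lambda^{[t,t+k]}]$. The map $\alpha:\mathcal{R}\to A$ sends $\mathbf{r}=(\mathbf{g}^{[t,t+k]})_{k,t}$ to $\prod_{i=+\infty}^{-\infty}\prod_{m=0}^{\ell}\mathbf{g}^{[i,i+m]}$, i.e. the sequence with time-$t$ component $\prod_{j=0}^{\ell}\bigl(\prod_{k=j}^{\ell}\chi^t(\mathbf{g}^{[t-j,t-j+k]})\bigr)$ (factors written left to right in increasing $j$, and increasing $k$ for each $j$); $\alpha$ is a bijection. The operation $*$ on $\mathcal{R}$ is $\dot{\mathbf{r}}*\ddot{\mathbf{r}}=\alpha^{-1}(\alpha(\dot{\mathbf{r}})\alpha(\ddot{\mathbf{r}}))$. For each $(k,t)$ let $G_k^t$ be a set of labels with a fixed bijection $[\Lambda^{[t,t+k]}]\to G_k^t$, $\mathbf{g}^{[t,t+k]}\mapsto g_k^t$. $\mathcal{U}=\prod_{t\in\mathbf{Z}}\prod_{0\le k\le\ell}G_k^t$, and $\beta:\mathcal{R}\to\mathcal{U}$ replaces each generator by its label. The operation $\circ$ on $\mathcal{U}$ is $\beta(\dot{\mathbf{r}})\circ\beta(\ddot{\mathbf{r}})=\beta(\dot{\mathbf{r}}*\ddot{\mathbf{r}})$;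 $(\mathcal{U},\circ)$ is the generator group. Upper triangles: $T_k^t=\{(m,t-j):0\le j\le\ell-k,\ k+j\le m\le\ell\}$ (lower vertex $(k,t)$, upper vertices $(\ell,t)$ and $(\ell,t-(\ell-k))$). For $\mathbf{u}=(g_m^s)\in\mathcal{U}$, $\nabla_{0,k}^t(\mathbf{u})=(g_m^s)_{(m,s)\in T_k^t}$, and $\nabla_{0,k}^t(\mathcal{U})=\{\nabla_{0,k}^t(\mathbf{u}):\mathbf{u}\in\mathcal{U}\}$. *)

(* Defs.v *)
From HB Require Import structures.
From mathcomp Require Import all_boot all_order all_algebra all_fingroup.
From mathcomp Require Import boolp classical_sets.

Set Implicit Arguments.
Unset Strict Implicit.
Unset Printing Implicit Defensive.

Import Order.TTheory GRing.Theory Num.Theory.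

Local Open Scope classical_set_scope.
Local Open Scope ring_scope.

Definition seqs (At : int -> finGroupType) : Type := forall t : int, At t.

HB.instance Definition _ At := gen_eqMixin (seqs At).
HB.instance Definition _ At := gen_choiceMixin (seqs At).

Section SeqsGroup.
Variable At : int -> finGroupType.
Implicit Types a b c : seqs At.

Definition seqs_one : seqs At := fun=> 1%g.
Definition seqs_mul a b : seqs At := fun t => (a t * b t)%g.
Definition seqs_inv a : seqs At := fun t => (a t)^-1%g.

Fact seqs_mulA : associative seqs_mul.
Proof. by move=> a b c; apply: functional_extensionality_dep => t; apply: mulgA. Qed.
Fact seqs_mul1 : left_id seqs_one seqs_mul.
Proof. by move=> a; apply: functional_extensionality_dep => t; apply: mul1g. Qed.
Fact seqs_mulr1 : right_id seqs_one seqs_mul.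
Proof. by move=> a; apply: functional_extensionality_dep => t; apply: mulg1. Qed.
Fact seqs_mulV : left_inverse seqs_one seqs_inv seqs_mul.
Proof. by move=> a; apply: functional_extensionality_dep => t; apply: mulVg. Qed.
Fact seqs_mulrV : right_inverse seqs_one seqs_inv seqs_mul.
Proof. by move=> a; apply: functional_extensionality_dep => t; apply: mulgV. Qed.

HB.instance Definition _ :=
  isGroup.Build (seqs At) seqs_mulA seqs_mul1 seqs_mulr1 seqs_mulV seqs_mulrV.

End SeqsGroup.

Section GroupSystem.
Variables (At : int -> finGroupType) (A : set (seqs At)).

Definition group_system : Prop :=
  [/\ A 1%g,
      forall a b, A a -> A b -> A (a * b)%g,
      forall a, A a -> A a^-1%g
    & forall (t : int) (x : At t), exists2 a, A a & a t = x].

Definition controllable (l : nat) : Prop :=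
  forall (t : int) (a1 a2 : seqs At), A a1 -> A a2 ->
    exists a, [/\ A a,
                  forall s : int, s < t -> a s = a1 s
                & forall s : int, t + l%:Z <= s -> a s = a2 s].

Definition complete_system : Prop :=
  forall a : seqs At,
    (forall m n : int, exists2 b, A b & forall s : int, m <= s <= n -> b s = a s) ->
    A a.

Definition span_in (m n : int) : set (seqs At) :=
  [set a | A a /\ forall s : int, ~~ (m <= s <= n) -> a s = 1%g].

Definition X (t : int) : set (seqs At) :=
  [set a | A a /\ forall s : int, s < t -> a s = 1%g].

Definition Y (t : int) : set (seqs At) :=
  [set a | A a /\ forall s : int, t < s -> a s = 1%g].

Definition set_mul (P Q : set (seqs At)) : set (seqs At) :=
  [set a | exists p q, [/\ P p, Q q & a = (p * q)%g]].

(* The set of cosets of M in N; it is only used for M normal in N, where left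
   and right cosets agree. *)
Definition cosets_of (N M : set (seqs At)) : set (set (seqs At)) :=
  [set C | exists2 x, N x & C = set_mul M [set x]].

Definition Lambda (k : nat) (t : int) : set (set (seqs At)) :=
  cosets_of (set_mul (X (t + 1)) (X t `&` Y (t + k%:Z)))
            (set_mul (X (t + 1)) (X t `&` Y (t + k%:Z - 1))).

Definition transversal_of (Q : set (set (seqs At))) (S : set (seqs At)) : Prop :=
  (forall g, S g -> exists2 C, Q C & C g) /\
  (forall C, Q C -> exists! g, S g /\ C g).

Record basis (l : nat) := Basis {
  gens : 'I_l.+1 -> int -> set (seqs At);
  gens_transversal : forall (k : 'I_l.+1) t, transversal_of (Lambda k t) (gens k t);
  gens_span : forall (k : 'I_l.+1) t, gens k t `<=` span_in t (t + k%:Z);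
  gens_one : forall k t, gens k t 1%g
}.

Section Generators.
Variables (l : nat) (B : basis l).

Definition tensor : Type := forall (k : 'I_l.+1) (t : int), gens B k t.

HB.instance Definition _ := gen_eqMixin tensor.
HB.instance Definition _ := gen_choiceMixin tensor.

Definition tensor1 : tensor := fun k t => SigSub (mem_set (gens_one B k t)).

(* The groups need not be abelian: big products over ordinals multiply from left
   to right in increasing order of the index, so generators that start later
   come first. *)
Definition alpha (r : tensor) : seqs At := fun t =>
  (\prod_(j < l.+1) \prod_(k < l.+1 | (j <= k)%N)
     (\val (r k (t - j%:Z)%R) : seqs At) t)%g.

(* When A is complete and l-controllable, alpha is a bijection from tensors
   onto A and this is its inverse; the default tensor1 is then never used
   on A. *)
Definition alpha_inv (a : seqs At) : tensor :=
  xget tensor1 [set r | alpha r = a].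

Definition tensor_op (r1 r2 : tensor) : tensor :=
  alpha_inv (alpha r1 * alpha r2)%g.

Record labelling := Labelling {
  label : 'I_l.+1 -> int -> Type;
  lab : forall k t, gens B k t -> label k t;
  unlab : forall k t, label k t -> gens B k t;
  labK : forall k t, cancel (@lab k t) (@unlab k t);
  unlabK : forall k t, cancel (@unlab k t) (@lab k t)
}.

Variable L : labelling.

Definition gen_group : Type := forall (k : 'I_l.+1) (t : int), label L k t.

Definition beta (r : tensor) : gen_group := fun k t => lab L (r k t).
Definition beta_inv (u : gen_group) : tensor := fun k t => unlab (u k t).

Definition gen_op (u1 u2 : gen_group) : gen_group :=
  beta (tensor_op (beta_inv u1) (beta_inv u2)).

(* These are the indices (m, s) of the generators whose time span [s, s + m]
   contains [t, t + k]. *)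
Definition upper_triangle (k : 'I_l.+1) (t : int) : set ('I_l.+1 * int) :=
  [set p : 'I_l.+1 * int |
    exists j : nat, [/\ (j <= l - k)%N, p.2 = t - j%:Z & (k + j <= p.1)%N]].

Definition nabla (k : 'I_l.+1) (t : int) (u : gen_group)
    : forall p : upper_triangle k t, label L (\val p).1 (\val p).2 :=
  fun p => u (\val p).1 (\val p).2.

Definition nabla_set (k : 'I_l.+1) (t : int) : Type := set_type (range (@nabla k t)).

Definition to_nabla (k : 'I_l.+1) (t : int) (u : gen_group) : nabla_set k t :=
  SigSub (mem_set (imageT (@nabla k t) u)).

End Generators.
End GroupSystem.

Arguments nabla {At A l B L} k t u p.

Definition is_group (T : Type) (op : T -> T -> T) : Prop :=
  exists (e : T) (inv : T -> T),
    [/\ associative op, left_id e op, right_id e op,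
        left_inverse e inv op & right_inverse e inv op].

(* Main.v *)
(* The indices in the triangle (k, t) are those of the generators that start at
   time t or earlier and end at time t + k or later. The generators starting
   after t contribute to [alpha r] a factor in X^(t+1), those ending before t + k
   do not affect the times from t + k on; hence the triangle of r determines,
   and by descending induction on k is determined by, the coset of [alpha r]
   modulo the normal subgroup X^(t+1) Y^(t+k-1). The triangles thus form the
   quotient of A by this subgroup. The same induction, started with
   controllability at k = l + 1, shows that every coset is reached, and the case
   k = 0 gives the surjectivity of alpha. *)
Require Import Defs.
From mathcomp Require Import all_boot all_order all_algebra all_fingroup.
From mathcomp Require Import boolp classical_sets zify.

Set Implicit Arguments.
Unset Strict Implicit.
Unset Printing Implicit Defensive.

Import Order.TTheory GRing.Theory Num.Theory.

Local Open Scope classical_set_scope.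
Local Open Scope ring_scope.

Lemma prodg_cons (gT : finGroupType) n (P : pred 'I_n) (F H : 'I_n -> gT)
    (i : 'I_n) (x : gT) :
    P i -> F i = (x * H i)%g -> (forall j, j != i -> F j = H j) ->
    (forall j : 'I_n, (j < i)%N -> H j = 1%g) ->
  (\prod_(j < n | P j) F j = x * \prod_(j < n | P j) H j)%g.
Proof.
move=> Pi Fi FH H1; rewrite big_mkcond [in RHS]big_mkcond /=.
elim: n P F H i Pi Fi FH H1 => [|n IH] P F H i Pi Fi FH H1; first by case: i {Pi Fi FH H1}.
rewrite !big_ord_recl; case: (unliftP ord0 i) => [i' | ] ei; subst i.
  rewrite FH // H1 // if_same !mul1g.
  apply: (IH (P \o lift ord0) (F \o lift ord0) (H \o lift ord0) i') => // [j ji|j ji].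
    by apply: FH; rewrite (inj_eq lift_inj).
  exact: H1.
rewrite Pi Fi -mulgA; congr (_ * (_ * _))%g.
by apply: eq_bigr => j _; rewrite FH.
Qed.

(** * Congruence modulo [X p * Y e] *)

Section Link.
Variables (At : int -> finGroupType) (A : set (seqs At)).
Hypothesis A_sys : group_system A.
Implicit Types (a b c : seqs At) (p e : int).

Lemma sys1 : A 1%g. Proof. by case: A_sys. Qed.
Lemma sysM a b : A a -> A b -> A (a * b)%g. Proof. by case: A_sys => _ + _ _; apply. Qed.
Lemma sysV a : A a -> A a^-1%g. Proof. by case: A_sys => _ _ + _; apply. Qed.

Lemma seqsM a b t : (a * b)%g t = (a t * b t)%g. Proof. by []. Qed.
Lemma seqsV a t : a^-1%g t = (a t)^-1%g. Proof. by []. Qed.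

(* For [a] and [b] in [A], this says that they lie in the same coset of the
   normal subgroup [X p * Y e]. *)
Definition link p e a b : Prop :=
  exists c, [/\ A c, forall s, s < p -> c s = a s & forall s, e < s -> c s = b s].

Lemma link_refl p e a : A a -> link p e a a. Proof. by exists a. Qed.

Lemma link_sym p e a b : A a -> A b -> link p e a b -> link p e b a.
Proof.
move=> Aa Ab [c [Ac ca cb]]; exists (a * c^-1 * b)%g; split.
- by apply: sysM => //; apply: sysM => //; apply: sysV.
- by move=> s sp; rewrite !(seqsM, seqsV) ca // mulgV mul1g.
- by move=> s sp; rewrite !(seqsM, seqsV) cb // mulgKV.
Qed.

Lemma link_trans p e b a c : A b -> link p e a b -> link p e b c -> link p e a c.
Proof.
move=> Ab [x [Ax xa xb]] [y [Ay yb yc]]; exists (x * b^-1 * y)%g; split.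
- by apply: sysM => //; apply: sysM => //; apply: sysV.
- by move=> s sp; rewrite !(seqsM, seqsV) xa // yb // mulgKV.
- by move=> s sp; rewrite !(seqsM, seqsV) xb // yc // mulgV mul1g.
Qed.

Lemma linkM p e a b a' b' :
  link p e a b -> link p e a' b' -> link p e (a * a')%g (b * b')%g.
Proof.
move=> [x [Ax xa xb]] [y [Ay ya yb]]; exists (x * y)%g; split.
- exact: sysM.
- by move=> s sp; rewrite !seqsM xa // ya.
- by move=> s sp; rewrite !seqsM xb // yb.
Qed.

Lemma link_le p e p' e' a b : p' <= p -> e <= e' -> link p e a b -> link p' e' a b.
Proof.
move=> pp ee [c [Ac ca cb]]; exists c; split=> // s hs.
  by apply: ca; apply: lt_le_trans hs pp.
by apply: cb; apply: le_lt_trans ee hs.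
Qed.

End Link.

(** * The map [alpha] and its values in [A] *)

Section Alpha.
Variables (At : int -> finGroupType) (A : set (seqs At)) (l : nat).
Hypothesis A_sys : group_system A.
Variable B : basis A l.
Implicit Types (r : tensor B) (a b c : seqs At) (s t : int).
Local Notation gen r k s := (\val (r k s) : seqs At).
Local Notation one := (tensor1 B).

Lemma gen_mem r k s : gens B k s (gen r k s).
Proof. exact: set_mem (valP (r k s)). Qed.

Lemma gen_sys r k s : A (gen r k s).
Proof. by have [] := gens_span (gen_mem r k s). Qed.

Lemma gen_out r (k : 'I_l.+1) s t : ~~ (s <= t <= s + k%:Z) -> gen r k s t = 1%g.
Proof. by have [_] := gens_span (gen_mem r k s); apply. Qed.

Lemma alpha_local r r' t :
    (forall (k : 'I_l.+1) s, s <= t -> t <= s + k%:Z -> r k s = r' k s) ->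
  alpha r t = alpha r' t.
Proof.
move=> rr'; apply: eq_bigr => j _; apply: eq_bigr => k jk.
by rewrite rr' //; lia.
Qed.

Lemma alpha_one : alpha one = 1%g.
Proof.
by apply: functional_extensionality_dep => t; rewrite /alpha big1 // => j _; apply: big1.
Qed.

(** In [alpha], later starts come first and, for equal starts, shorter lengths. A generator preceded
    only by trivial ones therefore splits off on the left, by [prodg_cons] in the outer and in the
    inner product. *)
Lemma alpha_cons r r0 (k0 : 'I_l.+1) s0 :
    (forall k s, ~~ ((k == k0) && (s == s0)) -> r k s = r0 k s) ->
    r0 k0 s0 = one k0 s0 ->
    (forall (k : 'I_l.+1) s, (s0 < s) || (s == s0) && (k < k0)%N -> r0 k s = one k s) ->
  alpha r = (gen r k0 s0 * alpha r0)%g.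
Proof.
move=> rr0 r0v r0pre; apply: functional_extensionality_dep => t; rewrite seqsM.
have [/andP[s0t ts0]|out] := boolP (s0 <= t <= s0 + k0%:Z); last first.
  rewrite gen_out // mul1g; apply: eq_bigr => j _; apply: eq_bigr => k jk.
  have [/andP[/eqP-> /eqP->]|/rr0->//] := boolP ((k == k0) && (t - j%:Z == s0)).
  by rewrite !gen_out.
(* At time [t] the generators starting at [s0] occur in the outer factor of index [t - s0]. *)
have j0lt : (`|t - s0|%N < l.+1)%N by have := ltn_ord k0; lia.
pose j0 := Ordinal j0lt.
have tj0 : t - j0%:Z = s0 by rewrite /=; lia.
apply: (prodg_cons (i := j0)) => //.
- rewrite tj0; apply: (prodg_cons (i := k0)) => //.
  + by rewrite /=; lia.
  + by rewrite r0v mulg1.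
  + by move=> k kk0; rewrite rr0 // (negbTE kk0).
  + by move=> k kk0; rewrite r0pre // eqxx kk0 orbT.
- move=> j jj0; apply: eq_bigr => k _; rewrite rr0 //.
  apply/negP => /andP[_ /eqP e]; case/eqP: jj0; apply/val_inj => /=; lia.
- move=> j jj0; apply: big1 => k _; rewrite r0pre //.
  by apply/orP; left; move: jj0 => /=; lia.
Qed.

Definition patch (P : 'I_l.+1 -> int -> bool) r r' : tensor B :=
  fun k s => if P k s then r k s else r' k s.

(** Finitely many generators are split off in the order of [alpha]: the outer induction removes the
    last starting time, the inner one its lengths from the shortest up. *)
Lemma alpha_fin (p : int) (d : nat) r :
    (forall k s, ~~ (p <= s < p + d%:Z) -> r k s = one k s) -> A (alpha r).
Proof.
elim: d r => [|d IHd] r r1.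
  suff -> : r = one by rewrite alpha_one; apply: sys1.
  apply: functional_extensionality_dep => k; apply: functional_extensionality_dep => s.
  by apply: r1; lia.
suff H n : (n <= l.+1)%N -> forall r,
    (forall k s, ~~ (p <= s < p + d.+1%:Z) -> r k s = one k s) ->
    (forall k : 'I_l.+1, (k < l.+1 - n)%N -> r k (p + d%:Z) = one k (p + d%:Z)) ->
    A (alpha r).
  apply: (H l.+1) => //; by rewrite subnn.
elim: n => [|n IHn] nl {}r {}r1 rn.
  apply: IHd => k s ks; have [->|sd] := eqVneq s (p + d%:Z).
    by apply: rn; rewrite subn0.
  apply: r1; lia.
have k0P : (l - n < l.+1)%N by lia.
pose k0 := Ordinal k0P; set s0 := p + d%:Z.
pose r0 := patch (fun k s => (k == k0) && (s == s0)) one r.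
rewrite (@alpha_cons r r0 k0 s0).
- apply: sysM => //; first exact: gen_sys.
  apply: IHn => [|k s ks|k kn]; first by lia.
    by rewrite /r0 /patch r1 // if_same.
  rewrite /r0 /patch eqxx andbT; case: eqVneq => // kk0.
  apply: rn; have : val k != val k0 by rewrite (inj_eq val_inj).
  by move=> /=; lia.
- by move=> k s /negbTE ks; rewrite /r0 /patch ks.
- by rewrite /r0 /patch !eqxx.
- move=> k s; rewrite /r0 /patch; case: ifP => // _ /orP[ss0|/andP[/eqP-> kk0]].
    by apply: r1; rewrite /s0 in ss0; lia.
  by apply: rn; move: kk0 => /=; lia.
Qed.

Hypothesis A_complete : complete_system A.

(** By completeness a finite window [[m, n]] suffices, and only generators starting in [[m - l, n]]
    reach it. *)
Lemma alpha_sys r : A (alpha r).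
Proof.
apply: A_complete => m n.
have [mn|nm] := lerP m n; last by exists 1%g; [exact: sys1 | lia].
pose r0 := patch (fun _ s => m - l%:Z <= s <= n) r one.
exists (alpha r0).
  apply: (@alpha_fin (m - l%:Z) (`|(n - m + l%:Z + 1)%R|%N) r0) => k s ks.
  by rewrite /r0 /patch ifN //; lia.
move=> t tmn; apply: alpha_local => k s st tsk.
by rewrite /r0 /patch ifT //; have := ltn_ord k; lia.
Qed.

(* The sequence linking the two images is the image of the tensor that follows
   [r] for the generators starting before [p], and [r'] for the others. *)
Lemma alpha_link p e r r' :
    (forall (k : 'I_l.+1) s, s < p -> e < s + k%:Z -> r k s = r' k s) ->
  link A p e (alpha r) (alpha r').
Proof.
move=> rr'; exists (alpha (patch (fun _ s => s < p) r r')); split.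
- exact: alpha_sys.
- move=> t tp; apply: alpha_local => k s st tsk.
  by rewrite /patch ifT //; lia.
- move=> t et; apply: alpha_local => k s st tsk; rewrite /patch.
  by case: ifP => // sp; apply: rr' => //; lia.
Qed.

(** * Cosets in [Lambda] and injectivity on triangles *)

Definition Msub (n i : int) : set (seqs At) :=
  set_mul (X A (i + 1)) (X A i `&` Y A (i + n - 1)).

Lemma coset_Lambda (k : 'I_l.+1) i c : X A i c -> Y A (i + k%:Z) c ->
  Lambda A k i (set_mul (Msub k%:Z i) [set c]).
Proof.
move=> Xc Yc; exists c => //; exists 1%g, c; split=> //; last by rewrite mul1g.
by split=> //; apply: sys1.
Qed.

(** If [a = x * z * c], then [z * c] is a link; conversely a link [b] gives the factors [a * b^-1]
    and [b * c^-1]. *)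
Lemma coset_memP (k : 'I_l.+1) i a c : A a -> X A i a -> X A i c ->
  set_mul (Msub k%:Z i) [set c] a <-> link A (i + 1) (i + k%:Z - 1) a c.
Proof.
move=> Aa [_ Xa] [Ac Xc]; split.
  move=> [_ [_ [[x [z [[Ax x1] [_ [Az z1]] ->]]] -> ->]]].
  exists (z * c)%g; split=> [|s si|s si]; first exact: sysM.
    by rewrite !seqsM x1 // mul1g.
  by rewrite seqsM z1 // mul1g.
move=> [b [Ab ba bc]].
exists (a * c^-1)%g, c; split=> //; last by rewrite mulgKV.
have AaV := sysV A_sys; have AM := sysM A_sys.
exists (a * b^-1)%g, (b * c^-1)%g; split; last by rewrite mulgA mulgKV.
  split; first by apply: AM => //; apply: AaV.
  by move=> s si; rewrite seqsM seqsV ba // mulgV.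
have Abc : A (b * c^-1)%g by apply: AM => //; apply: AaV.
split; split=> // s si; rewrite seqsM seqsV.
  by rewrite ba ?Xa ?Xc ?mulgV //; lia.
by rewrite bc // mulgV.
Qed.

Lemma gen_X r k s : X A s (gen r k s).
Proof.
by split; [exact: gen_sys | move=> t ts; apply: gen_out; lia].
Qed.

Lemma gen_Y r (k : 'I_l.+1) s : Y A (s + k%:Z) (gen r k s).
Proof.
by split; [exact: gen_sys | move=> t ts; apply: gen_out; lia].
Qed.

Lemma gen_link_inj r r' (k : 'I_l.+1) i :
  link A (i + 1) (i + k%:Z - 1) (gen r k i) (gen r' k i) -> r k i = r' k i.
Proof.
move=> rr'; apply: val_inj => /=.
have [_ tr] := gens_transversal B k i.
have [g [_ gU]] := tr _ (coset_Lambda (gen_X r' k i) (gen_Y r' k i)).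
have in_coset r1 : link A (i + 1) (i + k%:Z - 1) (gen r1 k i) (gen r' k i) ->
    g = gen r1 k i.
  move=> lk; apply: gU; split; first exact: gen_mem.
  by apply/coset_memP => //; [exact: gen_sys | exact: gen_X | exact: gen_X].
rewrite -(in_coset r) // -(in_coset r') //.
by apply: link_refl; exact: gen_sys.
Qed.

(* The generator at the lower vertex of the triangle comes first among those of
   the triangle, so it can be split off on the left; the rest of the triangle is
   covered by two smaller triangles. *)
Lemma link_alpha_inj n i r r' :
    link A (i + 1) (i + n%:Z - 1) (alpha r) (alpha r') ->
  forall (k : 'I_l.+1) s, s <= i -> i + n%:Z <= s + k%:Z -> r k s = r' k s.
Proof.
(* Induction downwards in [n]: a larger [n] gives a smaller triangle. The two smaller ones are those
   of [n.+1] at [i] and at [i - 1]. *)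
have [m] := ubnP (l.+1 - n)%N; elim: m n i r r' => // m IH n i r r' nm lk k s si sk.
have nl : (n < l.+1)%N by have := ltn_ord k; lia.
pose k0 := Ordinal nl.
have agree (k1 : 'I_l.+1) s1 : s1 <= i -> i + n%:Z <= s1 + k1%:Z ->
    ~~ ((k1 == k0) && (s1 == i)) -> r k1 s1 = r' k1 s1.
  move=> s1i sk1 ne.
  have [s1i'|s1i'] := eqVneq s1 i.
    subst s1.
    have kk0 : val k1 != val k0 by move: ne; rewrite eqxx andbT (inj_eq val_inj).
    rewrite /= in kk0.
    apply: (IH n.+1 i) => //; first by lia.
      by apply: link_le lk; lia.
    by lia.
  apply: (IH n.+1 (i - 1)); first by lia.
  - by apply: link_le lk; lia.
  - by lia.
  - by lia.
have [/andP[/eqP-> /eqP->]|/agree->//] := boolP ((k == k0) && (s == i)).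
pose T (k1 : 'I_l.+1) s1 := (s1 <= i) && (i + n%:Z <= s1 + k1%:Z).
(* The part of the triangle common to [r] and [r'], made trivial outside so that the vertex
   generator comes first in [cut r1]. *)
pose r0 := patch (fun k1 s1 => T k1 s1 && ~~ ((k1 == k0) && (s1 == i))) r' one.
pose cut (r1 : tensor B) := patch (fun k1 s1 => (k1 == k0) && (s1 == i)) r1 r0.
have cutE r1 : alpha (cut r1) = (gen r1 k0 i * alpha r0)%g.
  rewrite (@alpha_cons _ r0 k0 i).
  - by rewrite /cut /patch !eqxx.
  - by move=> k1 s1 /negbTE ks; rewrite /cut /patch ks.
  - by rewrite /r0 /patch !eqxx andbF.
  - move=> k1 s1 pre; rewrite /r0 /patch ifN //.
    by rewrite /T negb_and; apply/orP; left; move: pre => /=; lia.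
have cut_link r1 : (forall (k1 : 'I_l.+1) s1, s1 <= i -> i + n%:Z <= s1 + k1%:Z ->
    ~~ ((k1 == k0) && (s1 == i)) -> r1 k1 s1 = r' k1 s1) ->
    link A (i + 1) (i + n%:Z - 1) (alpha r1) (gen r1 k0 i * alpha r0)%g.
  move=> r1r'; rewrite -cutE; apply: alpha_link => k1 s1 s1i sk1.
  rewrite /cut /patch; have [//|ne] := boolP (_ && _).
  rewrite /r0 /patch ne andbT ifT; last by rewrite /T; lia.
  by apply: r1r' => //; lia.
have Ag r1 : A (gen r1 k0 i * alpha r0)%g.
  by apply: sysM => //; [exact: gen_sys | exact: alpha_sys].
apply: gen_link_inj; rewrite /=.
(* The common right factor [alpha r0] is cancelled. *)
rewrite -[gen r k0 i](mulgK (alpha r0)) -[gen r' k0 i](mulgK (alpha r0)).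
apply: linkM => //; last first.
  by apply: link_refl; apply: sysV => //; apply: alpha_sys.
apply: (link_trans A_sys (b := alpha r)); first exact: alpha_sys.
  by apply: link_sym => //; [exact: alpha_sys | exact: cut_link].
apply: (link_trans A_sys (b := alpha r')); first exact: alpha_sys.
  exact: lk.
exact: cut_link.
Qed.

(** * Surjectivity of [alpha] *)

Definition single (g : seqs At) : tensor B := fun k s =>
  if pselect (gens B k s g) is left h then SigSub (mem_set h) else one k s.

Lemma singleE g k s : gens B k s g -> gen (single g) k s = g.
Proof. by rewrite /single; case: pselect. Qed.

Hypothesis A_ctrl : controllable A l.

Lemma link_alpha_exists a n i : A a -> (n <= l.+1)%N ->
  exists r, link A (i + 1) (i + n%:Z - 1) a (alpha r).
Proof.
move=> Aa nl; have -> : n = (l.+1 - (l.+1 - n))%N by lia.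
move: (l.+1 - n)%N (leq_subr n l.+1) => m {n nl} ml.
elim: m ml i => [|m IH] ml i.
  exists one; have [c [Ac c1 c2]] := A_ctrl (i + 1) Aa (alpha_sys one).
  by exists c; split=> // s si; apply: c2; lia.
set n := (l.+1 - m.+1)%N; have nl : (n < l.+1)%N by rewrite /n; lia.
have nS : (l.+1 - m)%N = n.+1 by rewrite /n; lia.
rewrite nS in IH; move: n nl nS IH => n nl _ IH; pose k0 := Ordinal nl.
have [r1 lk1] := IH (ltnW ml) i; have [r2 lk2] := IH (ltnW ml) (i - 1).
(* The triangles of [r1] and [r2] overlap in that of [n.+2] at [i - 1], so they can be glued into
   [r0], which lacks only the lower vertex. *)
have r12 (k1 : 'I_l.+1) s1 : s1 < i -> i + n%:Z < s1 + k1%:Z -> r1 k1 s1 = r2 k1 s1.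
  move=> s1i sk1; apply: (@link_alpha_inj n.+2 (i - 1)); [|lia|lia].
  apply: (link_trans A_sys Aa).
    apply: link_sym => //; first exact: alpha_sys.
    by apply: link_le lk1; lia.
  by apply: link_le lk2; lia.
pose T (k1 : 'I_l.+1) s1 := (s1 <= i) && (i + n%:Z <= s1 + k1%:Z).
pose r0 := patch (fun k1 s1 => T k1 s1 && ~~ ((k1 == k0) && (s1 == i)))
             (patch (fun _ s1 => s1 < i) r2 r1) one.
have k0i (k1 : 'I_l.+1) s1 : (s1 != i) || (k1 != n :> nat) -> ~~ ((k1 == k0) && (s1 == i)).
  by move=> h; apply/negP => /andP[/eqP e /eqP e']; move: h; rewrite e e' !eqxx.
have lk10 : link A (i + 1) (i + n%:Z) a (alpha r0).
  apply: (link_trans A_sys (alpha_sys r1)); first by apply: link_le lk1; lia.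
  apply: alpha_link => k1 s1 s1i sk1; rewrite /r0 /patch ifT.
    by case: ifP => // s1i'; apply: r12.
  by rewrite k0i ?andbT /T; lia.
have lk20 : link A i (i + n%:Z - 1) a (alpha r0).
  apply: (link_trans A_sys (alpha_sys r2)); first by apply: link_le lk2; lia.
  apply: alpha_link => k1 s1 s1i sk1; rewrite /r0 /patch ifT.
    by rewrite s1i.
  by rewrite k0i ?andbT /T; lia.
case: lk10 => b [Ab ba b0]; case: lk20 => b' [Ab' b'a b'0].
have A0 := alpha_sys r0; have AV := sysV A_sys; have AM := sysM A_sys.
(* [z] is the defect of [r0]: [z * alpha r0] is linked to [a] through [b]. As [z] lies in [X i] and
   [Y (i + n)], the generator [g] of its coset can fill the vertex. *)
pose z := (b * b'^-1)%g; have Az : A z by apply: AM => //; apply: AV.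
have Xz : X A i z.
  by split=> // s si; rewrite /z seqsM seqsV ba ?b'a ?mulgV //; lia.
have Yz : Y A (i + k0%:Z) z.
  by split=> // s /= si; rewrite /z seqsM seqsV b0 ?b'0 ?mulgV //; lia.
have [_ tr] := gens_transversal B k0 i.
have [g [[Bg Cg] _]] := tr _ (coset_Lambda Xz Yz).
have gE := singleE Bg.
have Xg : X A i g by rewrite -gE; apply: gen_X.
have Ag : A g by case: Xg.
have lkg : link A (i + 1) (i + n%:Z - 1) g z by apply/(coset_memP k0).
pose r := patch (fun k1 s1 => (k1 == k0) && (s1 == i)) (single g) r0.
exists r.
have -> : alpha r = (g * alpha r0)%g.
  rewrite (@alpha_cons r r0 k0 i).
  - by rewrite /r /patch !eqxx gE.
  - by move=> k1 s1 /negbTE ks; rewrite /r /patch ks.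
  - by rewrite /r0 /patch !eqxx andbF.
  - move=> k1 s1 pre; rewrite /r0 /patch ifN //.
    by rewrite /T negb_and; apply/orP; left; move: pre => /=; lia.
apply: (link_trans A_sys (b := (z * alpha r0)%g)); first exact: AM.
  exists b; split=> // s si.
  by rewrite /z !(seqsM, seqsV) b'0 // mulgKV.
apply: linkM => //; last exact: link_refl.
by apply: link_sym.
Qed.

Lemma alpha_surj a : A a -> exists r, alpha r = a.
Proof.
move=> Aa.
(* For [n = 0] the two ranges of a link overlap at time [i], so [alpha (f i)] equals [a] there. The
   tensors [f i] agree where they must, and the diagonal one glues them. *)
have [f fP] := choice (fun i => link_alpha_exists i Aa (leq0n l.+1)).
exists (fun k s => f s k s); apply: functional_extensionality_dep => t.
have [c [_ ca cb]] := fP t.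
rewrite -ca; last by lia.
rewrite cb; last by lia.
apply: alpha_local => k s st tsk.
apply: (@link_alpha_inj k s) => //.
apply: (link_trans A_sys Aa).
  apply: link_sym => //; first exact: alpha_sys.
  by apply: link_le (fP s); lia.
by apply: link_le (fP t); lia.
Qed.

End Alpha.

(** * The quotient group on triangles *)

Theorem theorem39 (At : int -> finGroupType) (A : set (seqs At)) (l : nat)
    (l_gt0 : (0 < l)%N) (A_sys : group_system A)
    (A_ctrl : controllable A l) (A_complete : complete_system A)
    (B : basis A l) (L : labelling B) (k : 'I_l.+1) (t : int) :
  exists op : nabla_set L k t -> nabla_set L k t -> nabla_set L k t,
    (forall u1 u2 : gen_group L,
       op (to_nabla k t u1) (to_nabla k t u2) = to_nabla k t (gen_op u1 u2)) /\
    is_group op.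
Proof.
pose phi (u : gen_group L) := alpha (beta_inv u).
have phi_sys u : A (phi u) by exact: alpha_sys.
have phi_surj a : A a -> exists u, phi u = a.
  move=> Aa; have [r <-] := alpha_surj A_sys B A_complete A_ctrl Aa.
  exists (beta L r); congr alpha; apply: functional_extensionality_dep => k1.
  by apply: functional_extensionality_dep => s; apply: labK.
have phiM u v : phi (gen_op u v) = (phi u * phi v)%g.
  have [r rE] := alpha_surj A_sys B A_complete A_ctrl (sysM A_sys (phi_sys u) (phi_sys v)).
  rewrite -rE /phi; transitivity (alpha (tensor_op (beta_inv u) (beta_inv v))).
    congr alpha; apply: functional_extensionality_dep => k1.
    by apply: functional_extensionality_dep => s; apply: labK.
  (* The preimage [r] excludes the default value of [xget]. *)
  by rewrite /tensor_op /alpha_inv; case: xgetP => [r' _ -> //|/(_ r)[]].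
(* Equal triangles amount to congruent images in [A], so the operation can be computed on
   representatives [rep]. *)
have nablaP u v :
    to_nabla k t u = to_nabla k t v <-> link A (t + 1) (t + k%:Z - 1) (phi u) (phi v).
  split=> [/(congr1 val) /= uv|lk].
    apply: alpha_link => // k1 s st sk; congr unlab.
    have Tp : upper_triangle k t (k1, s).
      exists `|t - s|%N; rewrite /=; have := ltn_ord k1; split; lia.
    exact: (congr1 (fun f => f (SigSub (mem_set Tp))) uv).
  apply: val_inj => /=; apply: functional_extensionality_dep => -[[k1 s] Tp].
  have [j [/= jl sE kj]] := set_mem Tp; rewrite /= in sE kj; rewrite /nabla /=.
  have rE : beta_inv u k1 s = beta_inv v k1 s.
    by apply: (link_alpha_inj A_sys A_complete lk); lia.
  rewrite -[u k1 s]unlabK -[v k1 s]unlabK; exact: congr1 rE.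
have nabla_surj (x : nabla_set L k t) : exists u, to_nabla k t u = x.
  have /= [u _ ux] := set_mem (valP x); exists u; exact: val_inj.
have [rep repK] := choice nabla_surj.
pose op x y := to_nabla k t (gen_op (rep x) (rep y)).
have opE u v : op (to_nabla k t u) (to_nabla k t v) = to_nabla k t (gen_op u v).
  apply/nablaP; rewrite !phiM; apply: linkM => //; apply/nablaP; exact: repK.
(* This reduces each group axiom to an identity in [A]. *)
have phi_inj u v : phi u = phi v -> to_nabla k t u = to_nabla k t v.
  by move=> uv; apply/nablaP; rewrite uv; apply: link_refl.
have [e eE] := phi_surj _ (sys1 A_sys).
have [i iE] := choice (fun u => phi_surj _ (sysV A_sys (phi_sys u))).
exists op; split=> //; exists (to_nabla k t e), (fun x => to_nabla k t (i (rep x))).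
split.
- move=> x y z; rewrite -(repK x) -(repK y) -(repK z) !opE.
  by apply: phi_inj; rewrite !phiM mulgA.
- by move=> x; rewrite -(repK x) opE; apply: phi_inj; rewrite phiM eE mul1g.
- by move=> x; rewrite -(repK x) opE; apply: phi_inj; rewrite phiM eE mulg1.
- by move=> x; rewrite -[in X in op _ X](repK x) opE; apply: phi_inj; rewrite phiM iE eE mulVg.
- by move=> x; rewrite -[in X in op X _](repK x) opE; apply: phi_inj; rewrite phiM iE eE mulgV.
Qed.
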